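(* Let $C$ be a finite simple skew brace which is not a trivial skew brace. If $(C,\circ)$ is solvable, then $C$ is the first term of an infinite tower of finite simple skew braces with solvable multiplicative groups.
   Context: A skew brace is a triple $(B,+,\circ)$ such that $(B,+)$ and $(B,\circ)$ are groups (neither assumed abelian) on the same set and $a\circ(b+c)=a\circ b-a+a\circ c$ for all $a,b,c\in B$. The two identity elements coincide and are denoted $0$. Its lambda map is $\lambda^B:(B,\circ)\to\mathrm{Aut}(B,+)$, $\lambda^B_a(b)=-a+a\circ b$. The skew brace is trivial if $a\circ b=a+b$ for all $a,b$. An ideal is a subgroup $I\le(B,+)$ with $I\trianglelefteq(B,+)$, $I\trianglelefteq(B,\circ)$ and $\lambda^B_a(I)=I$ for all $a\in B$. A non-zero skew brace is simple if its only ideals are $0$ and $B$. A subbrace is a subset that is a subgroup of both $(B,+)$ and $(B,\circ)$. An infinite tower with first term $C$ means: a sequence of finite skew braces $C=C_0,C_1,C_2,\ldots$ such that, for some fixed prime $p$, $(C_m,+)\cong(C,+)^{p^m}$ for every $m\ge0$ and each $C_m$ embeds diagonally as a subbrace of $C_{m+1}$. Here ''embeds diagonally'' means that there is a group isomorphism $\psi:(C_{m+1},+)\to(C_m,+)^p$ such that $C_m\to C_{m+1}$, $a\mapsto\psi^{-1}(a,\dots,a)$, is an injective homomorphism of skew braces (respecting both $+$ and $\circ$). *)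

(* Defs.v *)
From HB Require Import structures.
From mathcomp Require Import all_boot all_fingroup all_solvable.

Set Implicit Arguments.
Unset Strict Implicit.
Unset Printing Implicit Defensive.

Declare Scope brace_scope.
Delimit Scope brace_scope with B.

Reserved Notation "a \circ b" (at level 40, left associativity).

(* Both groups may be nonabelian, hence nmodule.v, where addition is
   commutative, cannot be reused.  The two neutral elements are separate
   fields; sb_oneE shows that they coincide. *)
HB.mixin Record isSkewBrace B := {
  sb_add : B -> B -> B;
  sb_zero : B;
  sb_opp : B -> B;
  sb_circ : B -> B -> B;
  sb_one : B;
  sb_inv : B -> B;
  sb_addA : associative sb_add;
  sb_add0 : left_id sb_zero sb_add;
  sb_addN : left_inverse sb_zero sb_opp sb_add;
  sb_circA : associative sb_circ;
  sb_circ1 : left_id sb_one sb_circ;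
  sb_circV : left_inverse sb_one sb_inv sb_circ;
  sb_circD : forall a b c,
    sb_circ a (sb_add b c) =
      sb_add (sb_add (sb_circ a b) (sb_opp a)) (sb_circ a c)
}.

#[short(type="skewBraceType")]
HB.structure Definition SkewBrace := {B of isSkewBrace B}.

#[short(type="finSkewBraceType")]
HB.structure Definition FinSkewBrace := {B of isSkewBrace B & Finite B}.

Bind Scope brace_scope with SkewBrace.sort.
Bind Scope brace_scope with FinSkewBrace.sort.

Notation "0" := (@sb_zero _) : brace_scope.
Notation "a + b" := (sb_add a b) : brace_scope.
Notation "- a" := (sb_opp a) : brace_scope.
Notation "a \circ b" := (sb_circ a b) : brace_scope.

Local Open Scope brace_scope.

Section GeneralSkewBraces.

Variables B B' : skewBraceType.

Definition sb_lambda (a b : B) : B := - a + a \circ b.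

Definition trivial_brace : Prop := forall a b : B, a \circ b = a + b.

Definition brace_hom (f : B -> B') : Prop :=
  (forall a b, f (a + b) = f a + f b) /\
  (forall a b, f (a \circ b) = f a \circ f b).

End GeneralSkewBraces.

Arguments trivial_brace B : clear implicits.

(* Aliases of the carrier holding the group structures (B, +) and (B, o), both
   written multiplicatively by the library.  They are convertible to B, so a
   set of type {set B} can be cast to {set addg B} or {set circg B}. *)
Definition addg (B : finSkewBraceType) : Type := B.
Definition circg (B : finSkewBraceType) : Type := B.

Section Groups.

Variable B : finSkewBraceType.

HB.instance Definition _ := Finite.copy (addg B) B.
HB.instance Definition _ :=
  Finite_isGroup.Build (addg B) (@sb_addA B) (@sb_add0 B) (@sb_addN B).

HB.instance Definition _ := Finite.copy (circg B) B.
HB.instance Definition _ :=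
  Finite_isGroup.Build (circg B) (@sb_circA B) (@sb_circ1 B) (@sb_circV B).

End Groups.

Lemma sb_oneE (B : finSkewBraceType) : @sb_one B = 0.
Proof.
have := sb_circD (sb_one : B) 0 0; rewrite !sb_circ1 !sb_add0 => e.
have {}e : (1 = (sb_one : addg B)^-1 * 1)%g := e.
by have /esym/eqP := e; rewrite mulg1 invg_eq1 => /eqP.
Qed.

Section Ideals.

Variable B : finSkewBraceType.

Definition ideal (I : {set B}) : Prop :=
  [/\ group_set (I : {set addg B}) /\ ((I : {set addg B}) <| [set: addg B])%g,
      group_set (I : {set circg B}) /\ ((I : {set circg B}) <| [set: circg B])%g
    & forall a : B, [set sb_lambda a b | b in I] = I].

Definition simple_brace : Prop :=
  [set: B] <> [set 0] /\
  (forall I : {set B}, ideal I -> I = [set 0] \/ I = [set: B]).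

End Ideals.

Arguments simple_brace B : clear implicits.

Definition circ_solvable (B : finSkewBraceType) : bool :=
  solvable [set: circg B].

(* The group structure on {dffun _} is the library's external direct product,
   with pointwise operations. *)
Definition power_group (G : finGroupType) (n : nat) : finGroupType :=
  {dffun forall _ : 'I_n, G}.

Definition diag (G : finGroupType) (n : nat) (a : G) : power_group G n :=
  [ffun=> a].

Definition embeds_diagonally (p : nat) (C D : finSkewBraceType) : Prop :=
  exists (psi : addg D -> power_group (addg C) p)
         (psiV : power_group (addg C) p -> addg D),
    [/\ {morph psi : x y / (x * y)%g >-> (x * y)%g},
        cancel psi psiV, cancel psiV psi,
        injective (fun a : C => psiV (@diag (addg C) p a) : D)
      & @brace_hom C D (fun a => psiV (@diag (addg C) p a))].

Definition infinite_tower (C : finSkewBraceType)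
    (T : nat -> finSkewBraceType) : Prop :=
  T 0%N = C /\
  exists2 p : nat, prime p &
    forall m : nat,
      ([set: addg (T m)] \isog [set: power_group (addg C) (p ^ m)%N])%g /\
      embeds_diagonally p (T m) (T m.+1).

(* Main.v *)
(* Since (C, o) is solvable and nontrivial, it has a nonzero homomorphism f to
   Z/p for some prime p.  Put k(x) = sum_i f(x_i) on C^p, and
     (x o y)_i = x_i o y_(i + k(x)),
   so that (C^p, o) is a subgroup of the wreath product of (C, o) by Z/p, which
   is solvable.  This is a skew brace over (C, +)^p, k is a nonzero character
   of its multiplicative group, and k vanishes on the diagonal, which is
   therefore a copy of C; so the construction can be iterated with the same p.

   To see that it is simple, let I be an ideal of C^p and J the set of c such that c
   placed in one coordinate lies in I.  Then J is an ideal of C: for c in J the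
   constant vector c lies in I and has k = 0, so lambda_c(d) - d lies in J.  If
   J = C then I is everything.  If J = 0, commutators show that entries of
   elements of I are additively central.  If moreover k = 0 on I, these entries
   lie in the socle of C, which is 0.  If k(x) <> 0 for some x in I, then
   lambda_x(y) - y takes arbitrary values at a given coordinate, so the kernel
   of f lies in the socle, f is injective, and C would be trivial. *)

Require Import Defs.
From HB Require Import structures.
From mathcomp Require Import all_boot all_fingroup all_solvable.
From mathcomp Require Import ssralg finalg zmodp.

Set Implicit Arguments.
Unset Strict Implicit.
Unset Printing Implicit Defensive.

Import GRing.Theory.
Local Open Scope brace_scope.

(** * Arithmetic of skew braces, ideals and the socle *)

Section SkewBraceTheory.

Variable B : finSkewBraceType.
Implicit Types a b c : B.

Lemma sb_addr0 a : a + 0 = a.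
Proof. exact: (@mulg1 (addg B)). Qed.

Lemma sb_addrN a : a + - a = 0.
Proof. exact: (@mulgV (addg B)). Qed.

Lemma sb_oppK a : - - a = a.
Proof. exact: (@invgK (addg B)). Qed.

Lemma sb_addKr a b : - a + (a + b) = b.
Proof. exact: (@mulKg (addg B)). Qed.

Lemma sb_addNKr a b : a + (- a + b) = b.
Proof. exact: (@mulKVg (addg B)). Qed.

Lemma sb_addrK a b : a + b + - b = a.
Proof. exact: (@mulgK (addg B)). Qed.

Lemma sb_addrNK a b : a + - b + b = a.
Proof. exact: (@mulgKV (addg B)). Qed.

Lemma sb_oppD a b : - (a + b) = - b + - a.
Proof. exact: (@invMg (addg B)). Qed.

Lemma sb_addI a : injective (sb_add a).
Proof. exact: (@mulgI (addg B)). Qed.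

Lemma sb_opp0 : - 0 = 0 :> B.
Proof. exact: (@invg1 (addg B)). Qed.

Lemma sb_subr_eq0 a b : a + - b = 0 -> a = b.
Proof. by move=> e; rewrite -(sb_addrNK a b) e sb_add0. Qed.

Lemma sb_circ0 a : a \circ 0 = a.
Proof. by rewrite -sb_oneE; exact: (@mulg1 (circg B)). Qed.

Lemma sb_0circ a : 0 \circ a = a.
Proof. by rewrite -sb_oneE sb_circ1. Qed.

Lemma sb_circ_inv a : a \circ sb_inv a = 0.
Proof. by rewrite -sb_oneE; exact: (@mulgV (circg B)). Qed.

Lemma sb_inv_circ a : sb_inv a \circ a = 0.
Proof. by rewrite sb_circV sb_oneE. Qed.

Lemma sb_circE a b : a \circ b = a + sb_lambda a b.
Proof. by rewrite /sb_lambda sb_addNKr. Qed.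

Lemma sb_lambdaD a b c : sb_lambda a (b + c) = sb_lambda a b + sb_lambda a c.
Proof. by rewrite /sb_lambda sb_circD !sb_addA. Qed.

Lemma sb_lambdaM a b c :
  sb_lambda (a \circ b) c = sb_lambda a (sb_lambda b c).
Proof.
rewrite {1}/sb_lambda -sb_circA (sb_circE b c) sb_circD -sb_addA.
by rewrite -/(sb_lambda a (sb_lambda b c)) sb_addKr.
Qed.

Lemma sb_lambda0 a : sb_lambda a 0 = 0.
Proof. by rewrite /sb_lambda sb_circ0 sb_addN. Qed.

Lemma sb_0lambda b : sb_lambda 0 b = b.
Proof. by rewrite /sb_lambda sb_0circ sb_opp0 sb_add0. Qed.

Lemma sb_lambdaK a : cancel (sb_lambda a) (sb_lambda (sb_inv a)).
Proof. by move=> b; rewrite -sb_lambdaM sb_inv_circ sb_0lambda. Qed.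

Lemma sb_lambdaKV a : cancel (sb_lambda (sb_inv a)) (sb_lambda a).
Proof. by move=> b; rewrite -sb_lambdaM sb_circ_inv sb_0lambda. Qed.

(* Normality in (B, o) is traded for the condition that [lambda_x y - y] lies
   in [I] whenever [x] does. *)
Record ideal_axioms (I : {set B}) : Prop := IdealAxioms {
  ideal0 : 0 \in I;
  idealD : forall a b, a \in I -> b \in I -> a + b \in I;
  idealJ : forall a b, b \in I -> a + b + - a \in I;
  idealL : forall a b, b \in I -> sb_lambda a b \in I;
  idealS : forall a b, a \in I -> sb_lambda a b + - b \in I
}.

(** Finiteness spares [ideal_axioms] any closure under opposites or inverses: closure under the
    operations already gives subgroups, and an inclusion of a conjugate or lambda image in [I] is an
    equality by cardinality. *)
Lemma idealP (I : {set B}) : ideal I <-> ideal_axioms I.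
Proof.
split=> [[[gA nA] [gC nC] lI] | [I0 ID IJ IL IS]].
  have ID a b : a \in I -> b \in I -> a + b \in I.
    by case/group_setP: gA => _; exact.
  have IN a : a \in I -> - a \in I by move=> Ia; exact: (@groupVr _ (Group gA)).
  have IJ a b : b \in I -> a + b + - a \in I.
    move=> Ib; have /normsP nI := normal_norm nA.
    have := Ib; rewrite -(@memJ_conjg (addg B) I (- a) b) nI ?in_setT //.
    by rewrite /conjg (invgK (a : addg B)) mulgA.
  have IL a b : b \in I -> sb_lambda a b \in I.
    by move=> Ib; rewrite -(lI a); apply: imset_f.
  split=> //; first by case/group_setP: gA.
  move=> a b Ia.
  have Iab : ((a : circg B) ^ (b : circg B))%g \in (I : {set circg B}).
    by rewrite memJ_norm // (subsetP (normal_norm nC)) ?in_setT.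
  (* Here [a \circ b] is rewritten as [b] times the conjugate of [a] by [b], and that conjugate lies
     in [I]. *)
  have -> : sb_lambda a b + - b
     = - a + (b + sb_lambda b ((a : circg B) ^ (b : circg B))%g + - b).
    rewrite -sb_circE /sb_lambda -!sb_addA; congr (_ + (_ + _)).
    by apply: (@conjgC (circg B)).
  by apply: ID; [exact: IN | apply: IJ; apply: IL].
split.
- have gA : group_set (I : {set addg B}).
    by apply/group_setP; split=> // x y; exact: ID.
  split=> //; apply/andP; split; first exact: subsetT.
  apply/normsP=> a _; apply/eqP; rewrite eqEcard cardJg leqnn andbT.
  apply/subsetP=> _ /imsetP[x Ix ->].
  have := IJ (- a) x Ix; rewrite sb_oppK.
  by rewrite -sb_addA.
- have IC a b : a \in I -> b \in I -> a \circ b \in I.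
    by move=> Ia Ib; rewrite sb_circE; apply: ID => //; apply: IL.
  have gC : group_set (I : {set circg B}).
    apply/group_setP; split=> [|x y]; last exact: IC.
    by move: I0; rewrite -sb_oneE.
  split=> //; apply/andP; split; first exact: subsetT.
  apply/normsP=> a _; apply/eqP; rewrite eqEcard cardJg leqnn andbT.
  apply/subsetP=> _ /imsetP[x Ix ->].
  (* Write [x \circ a] as [u + a] with [u = x + (sb_lambda x a + - a)] in [I], then distribute
     [sb_inv a] over this sum. *)
  have -> : ((x : circg B) ^ (a : circg B))%g
      = sb_inv a + sb_lambda (sb_inv a) (x + (sb_lambda x a + - a))
        + - sb_inv a.
    change ((x : circg B) ^ (a : circg B))%g with (sb_inv a \circ (x \circ a)).
    rewrite -(sb_circE (sb_inv a)) (sb_circE x).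
    rewrite -{1}(sb_addrNK (sb_lambda x a) a) sb_addA sb_circD.
    by rewrite sb_inv_circ sb_addr0.
  by apply/IJ/IL/ID => //; apply: IS.
- move=> a; apply/eqP; rewrite eqEcard.
  rewrite card_imset ?leqnn ?andbT; last exact: can_inj (sb_lambdaK a).
  by apply/subsetP=> _ /imsetP[x Ix ->]; apply: IL.
Qed.

Lemma idealN (I : {set B}) a : ideal_axioms I -> a \in I -> - a \in I.
Proof.
by case/idealP=> [[gA _] _ _] Ia; exact: (@groupVr _ (Group gA)).
Qed.

Definition socle : {set B} :=
  [set a | [forall b, (sb_lambda a b == b) && (a + b == b + a)]].

Lemma socleP a :
  reflect (forall b, sb_lambda a b = b /\ a + b = b + a) (a \in socle).
Proof.
rewrite inE; apply: (iffP forallP) => H b.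
  by have /andP[/eqP-> /eqP->] := H b.
by have [-> ->] := H b; rewrite !eqxx.
Qed.

Lemma ideal_socle : ideal_axioms socle.
Proof.
have sJ a b : b \in socle -> a + b + - a = b.
  by case/socleP/(_ a) => _ <-; rewrite sb_addrK.
split.
- by apply/socleP=> b; rewrite sb_0lambda sb_addr0 sb_add0.
- move=> a b /socleP Sa /socleP Sb; apply/socleP=> c.
  have [e _] := Sa b; rewrite -{1}e -sb_circE sb_lambdaM.
  have [-> eb] := Sb c; have [-> ea] := Sa c.
  by rewrite -sb_addA eb sb_addA ea sb_addA.
- by move=> a b Sb; rewrite sJ.
- move=> a b /socleP Sb.
  have Cab c : sb_lambda a b + c = c + sb_lambda a b.
    by rewrite -(sb_lambdaKV a c) -!sb_lambdaD (Sb _).2.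
  (* As [lambda_a b] is additively central, it is also the conjugate of [b]
     by [a] in [(B, o)]. *)
  have e : sb_lambda a b = a \circ (b \circ sb_inv a).
    by rewrite (sb_circE b) (Sb _).1 sb_circD sb_circ_inv sb_addr0 sb_circE
               -Cab sb_addrK.
  apply/socleP=> c; split; last exact: Cab.
  by rewrite e !sb_lambdaM (Sb _).1 sb_lambdaKV.
- move=> a b /socleP/(_ b)[-> _]; rewrite sb_addrN.
  by apply/socleP=> c; rewrite sb_0lambda sb_addr0 sb_add0.
Qed.

End SkewBraceTheory.

(** * Characters of the multiplicative group *)

Section Characters.

Variables (q : nat) (B : finSkewBraceType) (f : B -> 'I_q.+2).

(** With the modulus in the form [q.+2], the type ['I_q.+2] is convertible to the ring ['Z_q.+2]; it
    also indexes the coordinates of the wreath brace. *)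
Definition character : Prop := forall a b, f (a \circ b) = (f a + f b)%R.

Hypothesis fM : character.

Lemma character0 : f 0 = 0%R.
Proof.
by have := fM 0 0; rewrite sb_0circ -{1}(addr0 (f 0)) => /addrI.
Qed.

Lemma characterV a : f (sb_inv a) = (- f a)%R.
Proof.
by apply: (addIr (f a)); rewrite addNr -fM sb_inv_circ character0.
Qed.

Definition sb_exp (a : B) n := iter n (sb_circ a) 0.

Lemma character_exp a n : f (sb_exp a n) = (f a *+ n)%R.
Proof.
by elim: n => [|n IHn]; rewrite ?character0 //= fM IHn mulrS.
Qed.

(** As the modulus is prime, [f a] is a unit, and the exponent is the representative of
    [s / f a]. *)
Lemma character_generated a s :
  prime q.+2 -> f a != 0%R -> exists n, f (sb_exp a n) = s.
Proof.
move=> p_pr fa_n0; have fa_unit : (f a : 'Z_q.+2) \is a GRing.unit.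
  rewrite -(natr_Zp (f a : 'Z_q.+2)) unitZpE // prime_coprime //.
  apply: contra fa_n0 => /dvdnP[k e].
  apply/eqP/val_inj => /=; case: k e => [->//|k] e.
  by have := ltn_ord (f a); rewrite /= e mulSn ltnNge leq_addr.
exists (nat_of_ord ((s : 'Z_q.+2) / f a)%R); rewrite character_exp -mulr_natl.
have -> : ((nat_of_ord ((s : 'Z_q.+2) / f a))%:R = (s : 'Z_q.+2) / f a)%R.
  exact: natr_Zp.
by rewrite divrK.
Qed.

Lemma sb_lambda_exp_fix (a b : B) n :
  sb_lambda a b = b -> sb_lambda (sb_exp a n) b = b.
Proof.
by move=> e; elim: n => [|n IHn]; rewrite ?sb_0lambda //= sb_lambdaM IHn.
Qed.

Lemma character_ker (a b : B) : f a = f b -> f (sb_inv a \circ b) = 0%R.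
Proof. by move=> e; rewrite fM characterV e addNr. Qed.

Lemma sb_inv_circ_eq0 (a b : B) : sb_inv a \circ b = 0 -> a = b.
Proof.
move=> e; have := sb_circ0 a; rewrite -{1}e sb_circA sb_circ_inv.
by rewrite sb_0circ.
Qed.

(* (B, o) is trivial or has prime order, so if some [a] moves [b] then [b] has
   trivial stabiliser; hence g |-> lambda_g b is onto and takes the value 0. *)
Lemma injective_character_trivial :
  prime q.+2 -> injective f -> trivial_brace B.
Proof.
move=> p_pr f_inj a b; rewrite sb_circE; congr (_ + _).
apply/eqP; apply: contraT => /eqP ab.
have lb_inj : injective (fun g => sb_lambda g b).
  move=> g h /= e; apply/esym/sb_inv_circ_eq0/eqP; apply: contraT => t0.
  have tb : sb_lambda (sb_inv h \circ g) b = b.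
    by rewrite sb_lambdaM e sb_lambdaK.
  (* The nonzero element [sb_inv h \circ g] fixes [b]; by injectivity of [f], [a] is one of its
     powers, so [a] would fix [b] too. *)
  have [|n /f_inj en] := @character_generated (sb_inv h \circ g) (f a) p_pr.
    by apply: contra t0 => /eqP; rewrite -character0 => /f_inj ->.
  by case: ab; rewrite -en sb_lambda_exp_fix.
have [r _ rK] := injF_bij lb_inj.
have b0 : b = 0.
  by apply: (can_inj (sb_lambdaK (r 0))); rewrite rK sb_lambda0.
by case: ab; rewrite b0 sb_lambda0.
Qed.

End Characters.

(* The phantom argument [fM] lets the instances below find the proof that
   [f] is a character. *)
Definition wreath q (B : finSkewBraceType) (f : B -> 'I_q.+2)
  (fM : character f) : Type := power_group (addg B) q.+2.

(** * Construction of the skew brace on a power of [B] *)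

Section Wreath.

Variables (q : nat) (B : finSkewBraceType) (f : B -> 'I_q.+2).
Hypothesis fM : character f.
Local Notation D := (wreath fM).
Implicit Types x y z : D.

HB.instance Definition _ := Finite.copy D (power_group (addg B) q.+2).

Definition coord x (i : 'I_q.+2) : B := (x : {ffun 'I_q.+2 -> B}) i.

Definition wreath_of (u : 'I_q.+2 -> B) : D := [ffun i => u i : addg B].

Lemma coordE u i : coord (wreath_of u) i = u i.
Proof. exact: ffunE. Qed.

Lemma coordP x y : (forall i, coord x i = coord y i) -> x = y.
Proof. by move=> e; apply/ffunP => i; exact: e. Qed.

Definition weight x : 'I_q.+2 := (\sum_i f (coord x i))%R.

Definition wreath_circ x y : D :=
  wreath_of (fun i => coord x i \circ coord y (i + weight x)%R).
Definition wreath_one : D := wreath_of (fun _ => sb_one).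
Definition wreath_inv x : D :=
  wreath_of (fun i => sb_inv (coord x (i - weight x)%R)).

Lemma weight_circ x y : weight (wreath_circ x y) = (weight x + weight y)%R.
Proof.
rewrite /weight; under eq_bigr => i _ do rewrite coordE fM.
rewrite big_split /=; congr (_ + _)%R; rewrite -/(weight x).
by rewrite [RHS](reindex_inj (addIr (weight x))).
Qed.

Lemma weight_inv x : weight (wreath_inv x) = (- weight x)%R.
Proof.
rewrite /weight; under eq_bigr => i _ do rewrite coordE (characterV fM).
rewrite sumrN; congr (- _)%R; rewrite -/(weight x).
by rewrite [RHS](reindex_inj (addIr (- weight x)%R)).
Qed.

Lemma weight_one : weight wreath_one = 0%R.
Proof.
by rewrite /weight big1 // => i _; rewrite coordE sb_oneE (character0 fM).
Qed.

(** Reusing the product of the power group makes the additive group agree with it by conversion, so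
    the identity serves as [psi] in [wreath_diagonal]. *)
Definition wreath_add x y : D :=
  ((x : power_group (addg B) q.+2) * (y : power_group (addg B) q.+2))%g.
Definition wreath_zero : D := (1 : power_group (addg B) q.+2)%g.
Definition wreath_opp x : D := (x : power_group (addg B) q.+2)^-1%g.

Lemma coordD x y i : coord (wreath_add x y) i = coord x i + coord y i.
Proof. exact: ffunE. Qed.

Lemma coord0 i : coord wreath_zero i = 0.
Proof. exact: ffunE. Qed.

Lemma coordN x i : coord (wreath_opp x) i = - coord x i.
Proof. exact: ffunE. Qed.

Fact wreath_circA : associative wreath_circ.
Proof.
move=> x y z; apply: coordP => i.
by rewrite !coordE weight_circ sb_circA addrA.
Qed.

Fact wreath_circ1 : left_id wreath_one wreath_circ.
Proof.
by move=> x; apply: coordP => i; rewrite !coordE sb_circ1 weight_one addr0.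
Qed.

Fact wreath_circV : left_inverse wreath_one wreath_inv wreath_circ.
Proof.
move=> x; apply: coordP => i.
by rewrite !coordE weight_inv sb_circV.
Qed.

Fact wreath_circD x y z : wreath_circ x (wreath_add y z) =
  wreath_add (wreath_add (wreath_circ x y) (wreath_opp x)) (wreath_circ x z).
Proof.
by apply: coordP => i; rewrite !(coordE, coordD, coordN) sb_circD.
Qed.

HB.instance Definition _ := isSkewBrace.Build D
  (@mulgA (power_group (addg B) q.+2) : associative wreath_add)
  (@mul1g (power_group (addg B) q.+2) : left_id wreath_zero wreath_add)
  (@mulVg (power_group (addg B) q.+2)
    : left_inverse wreath_zero wreath_opp wreath_add)
  wreath_circA wreath_circ1 wreath_circV wreath_circD.

Definition wreath_brace : finSkewBraceType := D.

End Wreath.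

(** * Coordinatewise computation in the wreath brace *)

Section WreathTheory.

Variables (q : nat) (B : finSkewBraceType) (f : B -> 'I_q.+2).
Hypothesis fM : character f.
Local Notation D := (wreath_brace fM).
Implicit Types (x y : D) (a b c d : B) (i j : 'I_q.+2).

Lemma coord_add x y i : coord (x + y) i = coord x i + coord y i.
Proof. exact: coordD. Qed.

Lemma coord_zero i : coord (0 : D) i = 0.
Proof. exact: coord0. Qed.

Lemma coord_opp x i : coord (- x) i = - coord x i.
Proof. exact: coordN. Qed.

Lemma coord_circ x y i :
  coord (x \circ y) i = coord x i \circ coord y (i + weight x)%R.
Proof. exact: coordE. Qed.

Lemma coord_lambda x y i :
  coord (sb_lambda x y) i
    = sb_lambda (coord x i) (coord y (i + weight x)%R).
Proof. by rewrite coord_add coord_opp coord_circ. Qed.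

Lemma weight_character : character (@weight q B f fM : D -> 'I_q.+2).
Proof. exact: weight_circ. Qed.

Definition delta i a : D := wreath_of fM (fun j => if j == i then a else 0).

Definition constant a : D := wreath_of fM (fun _ => a).

Lemma coord_delta i a j : coord (delta i a) j = if j == i then a else 0.
Proof. exact: coordE. Qed.

Lemma coord_constant a j : coord (constant a) j = a.
Proof. exact: coordE. Qed.

Lemma delta_add i a b : delta i (a + b) = delta i a + delta i b.
Proof.
apply: coordP => j; rewrite coord_add !coord_delta.
by case: eqP => // _; rewrite sb_add0.
Qed.

Lemma weight_delta i a : weight (delta i a) = f a.
Proof.
rewrite /weight (bigD1 i) //= coord_delta eqxx big1 ?addr0 // => j jni.
by rewrite coord_delta (negPf jni) character0.
Qed.

Lemma weight_delta2 i j a b :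
  i != j -> weight (delta i a + delta j b) = (f a + f b)%R.
Proof.
move=> inj; rewrite /weight (bigD1 i) //= (bigD1 j) 1?eq_sym //= big1.
  rewrite !coord_add !coord_delta !eqxx (negPf inj) eq_sym (negPf inj).
  by rewrite sb_addr0 sb_add0 addr0.
move=> k /andP[ki kj].
by rewrite coord_add !coord_delta (negPf ki) (negPf kj) sb_add0 character0.
Qed.

(** The number of coordinates equals the modulus, so equal entries cancel and the diagonal causes no
    shift. *)
Lemma weight_constant a : weight (constant a) = 0%R.
Proof.
rewrite /weight; under eq_bigr => i _ do rewrite coord_constant.
by rewrite sumr_const card_ord -mulr_natl (@pchar_Zp q.+2) // mul0r.
Qed.

(** The element [x] is the sum of its one-coordinate parts, accumulated through the truncations
    [trunc n]. *)
Lemma delta_support (I : {set D}) x :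
  ideal_axioms I -> (forall i, delta i (coord x i) \in I) -> x \in I.
Proof.
move=> idI dI.
pose trunc n : D := wreath_of fM (fun j => if j < n then coord x j else 0).
have truncE n j : coord (trunc n) j = if j < n then coord x j else 0.
  exact: coordE.
suff trI n : trunc n \in I.
  have -> : x = trunc q.+2 by apply: coordP => j; rewrite truncE ltn_ord.
  exact: trI.
elim: n => [|n IHn].
  have -> : trunc 0%N = 0 by apply: coordP => j; rewrite truncE.
  exact: ideal0 idI.
have [ltn|gen] := ltnP n q.+2; last first.
  have -> // : trunc n.+1 = trunc n.
  apply: coordP => j; rewrite !truncE (leq_trans (ltn_ord j) gen).
  by rewrite (leq_trans (ltn_ord j)) ?(leq_trans gen).
have -> : trunc n.+1 = trunc n + delta (Ordinal ltn) (coord x (Ordinal ltn)).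
  apply: coordP => j; rewrite coord_add coord_delta !truncE ltnS leq_eqVlt.
  have -> : (j == Ordinal ltn) = (nat_of_ord j == n) by [].
  case: eqP => [e | _]; last by rewrite sb_addr0.
  by rewrite e ltnn sb_add0; congr (coord x _); apply: val_inj.
by apply: idealD.
Qed.

Lemma delta_opp i a : delta i (- a) = - delta i a.
Proof.
apply: coordP => j; rewrite coord_opp !coord_delta.
by case: eqP => // _; rewrite sb_opp0.
Qed.

Lemma delta_zero i : delta i 0 = 0.
Proof. by apply: coordP => j; rewrite coord_delta coord_zero if_same. Qed.

(** * Simplicity of the wreath brace *)

Section SimpleWreath.

Hypotheses (p_pr : prime q.+2) (B_simple : simple_brace B).
Hypotheses (B_nontrivial : ~ trivial_brace B).
Hypothesis f_nonzero : exists a, f a != 0%R.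

Section Ideal.

Variable I : {set D}.
Hypothesis idI : ideal_axioms I.

(** An element of weight [i - j] carries the entry from [i] to [j]. Its own nonzero entry is placed
    at [j + 1], which differs from [j], so that lambda leaves the carried entry unchanged. *)
Lemma ideal_delta_shift i j a : delta i a \in I -> delta j a \in I.
Proof.
move=> Ia; have [b fb] := f_nonzero.
have [n fs] := @character_generated q B f fM b (i - j)%R p_pr fb.
have jn : (j == j + 1)%R = false.
  by rewrite -subr_eq0 opprD addNKr oppr_eq0 oner_eq0.
have -> : delta j a = sb_lambda (delta (j + 1)%R (sb_exp b n)) (delta i a).
  apply: coordP => k; rewrite coord_lambda weight_delta fs !coord_delta.
  have -> : (k + (i - j) == i)%R = (k == j).
    by rewrite addrC -[X in _ == X](subrK j i) (inj_eq (addrI _)).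
  case: (k =P j) => [-> | _]; last by rewrite sb_lambda0.
  by rewrite jn sb_0lambda.
exact: idealL.
Qed.

(* By [ideal_delta_shift] the slice does not depend on the coordinate. *)
Definition slice : {set B} := [set a | delta 0%R a \in I].

Lemma sliceP i a : (a \in slice) = (delta i a \in I).
Proof. by rewrite inE; apply/idP/idP; apply: ideal_delta_shift. Qed.

(** With weight zero, [sb_lambda x] permutes no coordinates, so it changes [delta i d] only at [i].
    The next two lemmas likewise produce elements of [I] supported at [i]. *)
Lemma slice_star x i d :
  x \in I -> weight x = 0%R -> sb_lambda (coord x i) d + - d \in slice.
Proof.
move=> Ix wx; rewrite (sliceP i).
have -> : delta i (sb_lambda (coord x i) d + - d)
   = sb_lambda x (delta i d) + - delta i d.
  apply: coordP => j; rewrite coord_add coord_opp coord_lambda wx addr0.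
  rewrite !coord_delta; case: eqP => [-> // | _].
  by rewrite sb_lambda0 sb_addrN.
exact: idealS.
Qed.

Lemma slice_commutator x i c :
  x \in I -> coord x i + (c + - coord x i + - c) \in slice.
Proof.
move=> Ix; rewrite (sliceP i).
have -> : delta i (coord x i + (c + - coord x i + - c))
   = x + (delta i c + - x + - delta i c).
  apply: coordP => j; rewrite !(coord_add, coord_opp, coord_delta).
  case: eqP => [-> // | _].
  by rewrite sb_opp0 sb_addr0 sb_add0 sb_addrN.
by apply: idealD => //; apply: idealJ => //; apply: idealN.
Qed.

Lemma slice_lambda x i a :
  x \in I -> f a = 0%R -> sb_lambda a (coord x i) + - coord x i \in slice.
Proof.
move=> Ix fa; rewrite (sliceP i).
have -> : delta i (sb_lambda a (coord x i) + - coord x i)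
   = sb_lambda (delta i a) x + - x.
  apply: coordP => j.
  rewrite !(coord_add, coord_opp, coord_delta, coord_lambda) weight_delta fa.
  rewrite addr0; case: eqP => [-> // | _].
  by rewrite sb_0lambda sb_addrN.
by apply: idealD; rewrite ?idealN ?idealL.
Qed.

(** The nonzero weight moves the entry of [delta 0 (- d)] away from coordinate 0, where only the
    subtracted term remains. *)
Lemma ideal_coord_onto x d :
  x \in I -> weight x != 0%R -> exists2 y, y \in I & coord y 0%R = d.
Proof.
move=> Ix wx; exists (sb_lambda x (delta 0%R (- d)) + - delta 0%R (- d)).
  exact: idealS.
rewrite coord_add coord_opp coord_lambda !coord_delta add0r (negPf wx) eqxx.
by rewrite sb_lambda0 sb_add0 sb_oppK.
Qed.

Lemma ideal_slice : ideal_axioms slice.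
Proof.
split=> [|a b|a b|a b|a b].
- by rewrite inE delta_zero; apply: ideal0.
- by rewrite !inE delta_add; apply: idealD.
- by rewrite !inE !delta_add delta_opp; apply: idealJ.
- rewrite !inE => Ib.
  (* The entry at coordinate 1 cancels the weight of [a], and it acts there on a zero entry. *)
  pose A := delta 0%R a + delta 1%R (sb_inv a).
  have -> : delta 0%R (sb_lambda a b) = sb_lambda A (delta 0%R b).
    apply: coordP => j; rewrite coord_lambda weight_delta2 //.
    rewrite (characterV fM) subrr addr0 coord_add !coord_delta.
    case: eqP => [-> | _]; last by rewrite sb_lambda0.
    by rewrite sb_addr0.
  exact: idealL.
- move=> Sa.
  have Ia : constant a \in I.
    by apply: delta_support idI _ => i; rewrite coord_constant -sliceP.
  have := slice_star 0%R b Ia (weight_constant a).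
  by rewrite coord_constant.
Qed.

End Ideal.

Lemma simple_wreath : simple_brace D.
Proof.
split.
  have [a fa] := f_nonzero => e; case/eqP: fa.
  have : delta 0%R a \in [set 0 : D] by rewrite -e inE.
  rewrite inE => /eqP e0; rewrite -(weight_delta 0%R a) e0.
  by rewrite /weight big1 // => i _; rewrite coord_zero character0.
move=> I /idealP idI.
have [S0|ST] := B_simple.2 _ ((idealP _).2 (ideal_slice idI)); last first.
  right; apply/setP=> x; rewrite inE; apply: delta_support => // i.
  by rewrite -sliceP // ST inE.
left.
have eq_of_slice a b : a + - b \in slice I -> a = b.
  by rewrite S0 inE => /eqP /sb_subr_eq0.
have socle0 : socle B = [set 0].
  have [//|sT] := B_simple.2 _ ((idealP _).2 (ideal_socle B)).
  case: B_nontrivial => a b.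
  have : a \in socle B by rewrite sT inE.
  by case/socleP/(_ b) => e _; rewrite sb_circE e.
(* The slice is zero, so the commutators of [slice_commutator] vanish. *)
have comm x i c : x \in I -> coord x i + c = c + coord x i.
  move=> Ix; apply: eq_of_slice; rewrite sb_oppD.
  by have := slice_commutator idI i c Ix; rewrite !sb_addA.
have [/existsP[x /andP[Ix wx]] | /existsPn w0] :=
  boolP [exists x, (x \in I) && (weight x != 0%R)].
(* Every [d] is an entry of an element of [I]. Hence [(B, +)] is abelian and the kernel of [f] acts
   trivially, so it lies in the zero socle. *)
- case: B_nontrivial; apply: (injective_character_trivial fM p_pr) => a b fab.
  apply: sb_inv_circ_eq0; apply/set1P; rewrite -socle0; apply/socleP => d.
  have [y Iy <-] := ideal_coord_onto idI d Ix wx.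
  split; first by apply/eq_of_slice/slice_lambda/character_ker.
  by rewrite comm.
- apply/setP=> x; rewrite inE; apply/idP/eqP => [Ix | ->]; last exact: ideal0.
  have wx : weight x = 0%R.
    by have := w0 x; rewrite Ix /= negbK => /eqP.
  apply: coordP => i; rewrite coord_zero; apply/set1P; rewrite -socle0.
  apply/socleP=> d; split; last exact: comm.
  exact/eq_of_slice/slice_star.
Qed.

End SimpleWreath.

(** * Diagonal embedding, nontriviality and solvability *)

Lemma wreath_diagonal : embeds_diagonally q.+2 B D.
Proof.
exists id, id; split=> //.
  move=> a b /(congr1 (fun x : D => coord x 0%R)).
  by rewrite /coord !ffunE.
split=> a b; apply: (@coordP _ _ _ fM) => i.
  by rewrite coord_add /coord !ffunE.
rewrite coord_circ (_ : weight _ = 0%R) /coord ?ffunE //.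
by rewrite -(weight_constant a).
Qed.

Lemma wreath_nontrivial : ~ trivial_brace B -> ~ trivial_brace D.
Proof.
move=> nB tD; apply: nB => a b.
have := congr1 (fun x => coord x 0%R) (tD (constant a) (constant b)).
by rewrite coord_circ coord_add !coord_constant.
Qed.

Lemma weight_nonzero : (exists a, f a != 0%R) -> exists x, weight x != 0%R.
Proof. by case=> a fa; exists (delta 0%R a); rewrite weight_delta. Qed.

Lemma weight_morphM :
  {in [set: circg D] &,
    {morph (@weight q B f fM : circg D -> 'Z_q.+2) : x y / (x * y)%g}}.
Proof. by move=> x y _ _; exact: weight_character. Qed.

(** The weight has abelian image. On its kernel the circle operation is coordinatewise, so each
    coordinate is a homomorphism to [(B, \circ)] and the derived series dies as it does there. *)
Lemma wreath_solvable : circ_solvable B -> circ_solvable D.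
Proof.
move=> solB; pose w := Morphism weight_morphM.
rewrite /circ_solvable.
rewrite (series_sol (ker_normal w)); apply/andP; split; last first.
  rewrite (isog_sol (first_isog w)).
  exact/abelian_sol/FinRing.zmod_abelian.
have coordM i : {in ('ker w)%g &,
    {morph (fun x : circg D => @coord q B f fM x i : circg B) :
      x y / (x * y)%g}}.
  move=> x y /kerP - /(_ (in_setT _)) wx _.
  by have := coord_circ x y i; rewrite [weight x]wx addr0.
have /derivedP[n dB] := solB.
apply/derivedP; exists n; apply/trivgP/subsetP => x dx.
rewrite inE; apply/eqP; apply: coordP => i.
pose ci := Morphism (coordM i).
have : ci x \in [set: circg B]^`(n)%g.
  have := mem_morphim ci (subsetP (der_sub n _) _ dx) dx.
  by rewrite morphim_der //; apply: (subsetP (dergS n (subsetT _))).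
rewrite dB inE => /eqP /= ->.
by rewrite /= coordE.
Qed.

End WreathTheory.

(** * Iterated powers of the additive group *)

(** Total maps in both directions, rather than [isog], can be applied coordinate by coordinate in
    [group_equiv_power]. *)
Definition group_equiv (G H : finGroupType) : Prop :=
  exists (g : G -> H) (h : H -> G),
    [/\ {morph g : x y / (x * y)%g >-> (x * y)%g}, cancel g h & cancel h g].

Lemma group_equiv_isog (G H : finGroupType) :
  group_equiv G H -> ([set: G] \isog [set: H])%g.
Proof.
case=> g [h [gM gK hK]].
have gM' : {in [set: G] &, {morph g : x y / (x * y)%g}} by move=> x y _ _.
apply/isogP; exists (Morphism gM').
  by apply/injmP=> x y _ _ /=; apply: (can_inj gK).
apply/setP=> y; rewrite inE; apply/imsetP; exists (h y).
  by rewrite !inE.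
by rewrite /= hK.
Qed.

Lemma group_equiv_power1 (G : finGroupType) : group_equiv G (power_group G 1).
Proof.
exists (@diag G 1), (fun x => (x : {ffun 'I_1 -> G}) ord0); split.
- by move=> x y; apply/ffunP=> i; rewrite !ffunE.
- by move=> x; rewrite ffunE.
- by move=> x; apply/ffunP=> i; rewrite !ffunE (ord1 i).
Qed.

Lemma group_equiv_power (G H : finGroupType) m n :
  group_equiv G (power_group H n) ->
  group_equiv (power_group G m) (power_group H (m * n)).
Proof.
case=> g [h [gM gK hK]].
have cE : #|{: 'I_m * 'I_n}| = (m * n)%N by rewrite card_prod !card_ord.
pose r (u : 'I_m * 'I_n) : 'I_(m * n) := cast_ord cE (enum_rank u).
pose s (k : 'I_(m * n)) : 'I_m * 'I_n := enum_val (cast_ord (esym cE) k).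
have rK : cancel r s by move=> u; rewrite /s /r cast_ordK enum_rankK.
have sK : cancel s r by move=> k; rewrite /s /r enum_valK cast_ordKV.
pose g' (x : {ffun 'I_m -> G}) : {ffun 'I_(m * n) -> H} :=
  [ffun k => (g (x (s k).1) : {ffun 'I_n -> H}) (s k).2].
pose h' (y : {ffun 'I_(m * n) -> H}) : {ffun 'I_m -> G} :=
  [ffun i => h [ffun j => y (r (i, j))]].
exists g', h'; split.
- by move=> x y; apply/ffunP=> k; rewrite !ffunE gM !ffunE.
- move=> x; apply/ffunP=> i; rewrite ffunE -[RHS]gK; congr (h _).
  by apply/ffunP=> j; rewrite !ffunE rK.
- move=> y; apply/ffunP=> k; rewrite !ffunE hK ffunE.
  by rewrite -surjective_pairing sK.
Qed.

(** * Existence of a character, and the tower *)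

(** A nontrivial solvable group has a normal subgroup [H] of prime index; the character is the
    projection modulo [H], nonzero outside [H]. *)
Lemma solvable_character (B : finSkewBraceType) :
  simple_brace B -> circ_solvable B ->
  exists (q : nat) (f : B -> 'I_q.+2),
    [/\ prime q.+2, character f & exists a, f a != 0%R].
Proof.
case=> nB _ solB.
have nt : [set: circg B] != 1%g.
  apply/eqP=> e; case: nB; apply/setP=> a.
  have /set1P a1 : (a : circg B) \in (1%g : {set circg B}) by rewrite -e inE.
  by rewrite !inE [a]a1; apply/esym/eqP/sb_oneE.
have [H nHG] := sol_prime_factor_exists solB nt.
case Ep: #|_ : H|%g => [|[|q]] // p_pr; exists q.
have cQ : #|([set: circg B] / H)%g| = q.+2.
  by rewrite card_quotient ?normal_norm.
have isoQ : ([set: circg B] / H \isog [set: 'Z_q.+2])%g.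
  rewrite isog_cyclic_card ?prime_cyclic ?cQ ?cardsT ?card_ord //.
  exact: eqxx.
have [g gI _] := isogP isoQ.
have cosetQ a : coset H (a : circg B) \in ([set: circg B] / H)%g.
  by rewrite mem_quotient ?inE.
have nHa (a : circg B) : a \in 'N(H)%g.
  by rewrite (subsetP (normal_norm nHG)) ?inE.
exists (fun a => g (coset H (a : circg B))); split=> // [a b|].
  have e := morphM (coset H) (nHa a) (nHa b).
  by rewrite [LHS](congr1 g e); apply: (morphM g (cosetQ a) (cosetQ b)).
have [a aH] : exists a, a \notin H.
  apply/existsP; rewrite -negb_forall; apply: contraL p_pr => /forallP allH.
  rewrite -Ep; suff -> : H = [set: circg B]%G by rewrite indexgg.
  by apply/val_inj/setP=> a; rewrite allH inE.
exists a; apply: contra aH => /eqP ga1.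
apply: coset_idr (nHa a) _.
by apply: (injmP gI); rewrite ?group1 // [LHS]ga1 morph1.
Qed.

(** The character travels with the brace because the weight of one stage is the character used for
    the next; this keeps the prime fixed. *)
Record brace_with_character q := BraceWithCharacter {
  base_brace : finSkewBraceType;
  base_character : base_brace -> 'I_q.+2;
  base_characterM : character base_character
}.

Definition wreath_step q (X : brace_with_character q) :=
  BraceWithCharacter (@weight_character q _ _ (@base_characterM q X)).

Theorem corollary4p7 :
  forall C : finSkewBraceType,
    simple_brace C ->
    ~ trivial_brace C ->
    circ_solvable C ->
    exists T : nat -> finSkewBraceType,
      infinite_tower C T /\
      (forall m : nat, simple_brace (T m) /\ circ_solvable (T m)).
Proof.
move=> C simC ntC solC.
have [q [f [p_pr fM f_n0]]] := solvable_character simC solC.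
pose X m := iter m (@wreath_step q) (BraceWithCharacter fM).
have XP m : [/\ simple_brace (base_brace (X m)),
    ~ trivial_brace (base_brace (X m)), circ_solvable (base_brace (X m))
  & exists a, @base_character q (X m) a != 0%R].
  elim: m => [|m [simX ntX solX Xn0]]; first by split.
  split; [exact: simple_wreath | exact: wreath_nontrivial
         | exact: wreath_solvable | exact: weight_nonzero].
have addX m : group_equiv (addg (base_brace (X m)))
                (power_group (addg C) (q.+2 ^ m)).
  elim: m => [|m IHm]; first exact: group_equiv_power1.
  (* By conversion, the additive group of stage [m.+1] is the power with exponent [q.+2] of that of
     stage [m]. *)
  rewrite expnS; have [g [h [gM gK hK]]] := group_equiv_power q.+2 IHm.
  by exists g, h.
exists (fun m => base_brace (X m)); split; last by move=> m; case: (XP m).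
split=> //; exists q.+2 => // m; split; first exact: group_equiv_isog (addX m).
exact: wreath_diagonal.
Qed.
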